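(* It holds that $LB_\alpha^{\#}\ge{LB_\alpha^{\#}}'=LB^*_\alpha$, where $LB_\alpha^{\#}=\min\{LB\in\mathbb{R}:\mathcal{L}_\alpha(LB)=LB\}$, ${LB_\alpha^{\#}}'=\min\{LB\in\mathbb{R}:\mathcal{L}'_\alpha(LB)=LB\}$, and $LB^*_\alpha$ is the optimal objective function value of (APC2-Ry).
   Context: Given are a finite set of points $N$, a positive integer $p<|N|$, a positive integer $\alpha\le p$, and distances $d_{ij}\ge 0$ for $i,j\in N$ (an instance of the discrete $\alpha$-neighbor $p$-center problem). $\mathcal{L}_\alpha(LB)$ denotes the optimal objective function value of the linear program (APCLB) in real variables $y_j$ ($j\in N$), $x_{ij}$ ($i,j\in N$, $i\ne j$), $z$: minimize $z$ subject to - (1) $\sum_{j\in N} y_j=p$; - (2) $\sum_{j\in N\setminus\{i\}} x_{ij}=\alpha(1-y_i)$ for all $i\in N$; - (3) $x_{ij}\le y_j$ for all $i,j\in N$, $i\ne j$; - (4) $y_i+x_{ij}\le1$ for all $i,j\in N$, $i\neq j$; - (5) $LB\,y_i+\max\{LB,d_{ij}\}x_{ij}\le z$ for all $i,j\in N$, $i\ne j$; - (6) $\alpha\,LB\,y_i+\sum_{j\in N\setminus\{i\}}\max\{LB,d_{ij}\}x_{ij}\le\alpha z$ for all $i\in N$; - (7) $0\le x_{ij}$ for all $i,j\in N$, $i\ne j$; $0\le y_j\le 1$ for all $j\in N$; $z\ge LB$. $\mathcal{L}'_\alpha(LB)$ denotes the optimal objective function value of the linear program (APCLB') obtained from (APCLB)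 by removing (4) and replacing (5) by $\max\{LB,d_{ij}\}x_{ij}\le z$ for all $i,j\in N$, $i\ne j$. Let $D=\{d_{ij}: i,j\in N, i\ne j\}=\{d_1,\dots,d_K\}$ with $d_1<d_2<\dots<d_K$, and for $i\in N$ let $D_i=\{d_{ij}: j\in N\setminus\{i\}\}\setminus\{d_1\}$. The semi-relaxation (APC2-Ry), in variables $u_k$ ($k=2,\dots,K$) and $y_j$ ($j\in N$), is: minimize $d_1+\sum_{k=2}^K(d_k-d_{k-1})u_k$ subject to - $\sum_{j\in N}y_j=p$; - $u_{k-1}\ge u_k$ for all $k\in\{3,\dots,K\}$; - $\alpha u_k+\sum_{j\in N\setminus\{i\}: d_{ij}<d_k} y_j\ge \alpha(1-y_i)$ for all $i\in N$ and all $d_k\in D_i$; - $u_k\in\{0,1\}$ for all $k\in\{2,\dots,K\}$; $0\le y_j\le 1$ for all $j\in N$. *)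

(* Defs.v *)
From mathcomp Require Import all_boot all_order all_algebra.
From mathcomp Require Import all_classical all_reals all_analysis.

Set Implicit Arguments.
Unset Strict Implicit.
Unset Printing Implicit Defensive.

Import Order.TTheory GRing.Theory Num.Theory.

Local Open Scope classical_set_scope.
Local Open Scope ring_scope.

(** Optimal objective function value of "minimize [f v] subject to [P v]".
    Being extended-real valued, it is [+oo] for an infeasible program, so that
    no junk real number is ever taken for an optimal value. *)
Definition optimal_value (R : realType) (V : Type) (P : set V) (f : V -> R)
  : \bar R := ereal_inf [set (f v)%:E | v in P].

Definition is_minimum (R : realType) (S : set R) (m : R) : Prop :=
  S m /\ lbound S m.

Section AlphaNeighborPCenter.
Variables (R : realType) (N : finType) (d : N -> N -> R) (p alpha : nat).

(** A candidate solution is [(y, x, z)]; the diagonal entries [x i i] are not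
    variables of the program and occur in no constraint. *)
Definition lp_vars : Type := ((N -> R) * (N -> N -> R) * R)%type.

Section LB.
Variable LB : R.

Record APCLB_common (y : N -> R) (x : N -> N -> R) (z : R) : Prop := {
  lp_card : \sum_(j : N) y j = p%:R;
  lp_assign : forall i, \sum_(j | j != i) x i j = alpha%:R * (1 - y i);
  lp_open : forall i j, i != j -> x i j <= y j;
  lp_radius_sum : forall i,
    alpha%:R * LB * y i + \sum_(j | j != i) Num.max LB (d i j) * x i j
      <= alpha%:R * z;
  lp_x_ge0 : forall i j, i != j -> 0 <= x i j;
  lp_y_01 : forall j, 0 <= y j <= 1;
  lp_z_ge : LB <= z }.

Definition APCLB : set lp_vars := [set v | let: (y, x, z) := v in
  [/\ APCLB_common y x z,
      forall i j, i != j -> y i + x i j <= 1 &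
      forall i j, i != j -> LB * y i + Num.max LB (d i j) * x i j <= z]].

Definition APCLB' : set lp_vars := [set v | let: (y, x, z) := v in
  APCLB_common y x z /\
  forall i j, i != j -> Num.max LB (d i j) * x i j <= z].

Definition calL : \bar R := optimal_value APCLB (fun v => v.2).

Definition calL' : \bar R := optimal_value APCLB' (fun v => v.2).

End LB.

(** [dists = [:: d_1; ...; d_K]], duplicate free and increasing. *)
Definition dists : seq R :=
  sort <=%R (undup [seq d ij.1 ij.2 | ij in [pred ij : N * N | ij.1 != ij.2]]).

Definition K : nat := size dists.

(** [dist_ k] is [d_k] for [1 <= k <= K]; the indices are 1-based. *)
Definition dist_ (k : nat) : R := nth 0 dists k.-1.

Definition dists_of (i : N) : seq R :=
  [seq r <- [seq d i j | j in predC1 i] | r != dist_ 1].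

(** A candidate solution is [(u, y)]; only [u k] with [2 <= k <= K] matters. *)
Definition APC2_Ry : set ((nat -> R) * (N -> R)) := [set v | let: (u, y) := v in
  [/\ \sum_(j : N) y j = p%:R,
      forall k, (3 <= k <= K)%N -> u k <= u k.-1,
      forall i k, (2 <= k <= K)%N -> dist_ k \in dists_of i ->
        alpha%:R * (1 - y i) <=
          alpha%:R * u k + \sum_(j | (j != i) && (d i j < dist_ k)) y j,
      forall k, (2 <= k <= K)%N -> u k = 0 \/ u k = 1 &
      forall j, 0 <= y j <= 1]].

Definition APC2_Ry_objective (v : (nat -> R) * (N -> R)) : R :=
  dist_ 1 + \sum_(2 <= k < K.+1) (dist_ k - dist_ k.-1) * v.1 k.

Definition APC2_Ry_value : \bar R := optimal_value APC2_Ry APC2_Ry_objective.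

End AlphaNeighborPCenter.

(* Main.v *)
Require Import Defs.
From mathcomp Require Import all_boot all_order all_algebra.
From mathcomp Require Import all_classical all_reals all_analysis.
From mathcomp Require Import lra zify.

Set Implicit Arguments.
Unset Strict Implicit.
Unset Printing Implicit Defensive.

Import Order.TTheory GRing.Theory Num.Theory.
Local Open Scope classical_set_scope.
Local Open Scope ring_scope.

(** Everything is reduced to a covering condition on the location variables
    alone.  Call [LB] coverable if some [y] in the unit box with
    [\sum_j y j = p] satisfies, for every [i],
      [alpha * (1 - y i) <= \sum_(j != i, d i j <= LB) cap y i j],
    where the capacity [cap y i j] bounds the share of the demand of [i] that
    may be assigned to [j]: it is [y j] for [APCLB'] and
    [Num.min (y j) (1 - y i)] for [APCLB], because of [y i + x i j <= 1].

    - A bound is a fixed point of [calL] (resp. [calL']) iff it is coverable for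
      the corresponding capacity ([calL_coverable], [calL'_coverable]).
      Subtracting [LB] times [lp_assign] from [lp_radius_sum] gives
      [\sum_j (max LB (d i j) - LB) * x i j <= alpha * (z - LB)], so [z = LB]
      forces every assignment farther than [LB] to vanish, and the remaining
      ones fit in the capacities.  Conversely, a covering [y] allows
      an assignment at distance at most [LB], for which [z = LB] is feasible.
      The optimal value being an infimum, one only gets solutions with [z]
      close to [LB]; compactness of the box turns the approximate coverings
      they provide into an exact one ([box_approx_solution]).
    - Coverability depends on [LB] only through the comparisons [d i j <= LB],
      so it passes from [LB] to the largest distance not exceeding it.  Hence the
      least coverable bound exists and is a distance ([least_coverable]), as
      soon as some bound is coverable; opening [p >= alpha] points and taking
      [LB] large provides one ([exists_coverable]).
    - A feasible binary nonincreasing [u] of [APC2_Ry] is a step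
      [u k = (k <= m)], its objective telescopes to [d_m], and the constraints
      with [u k = 0] say precisely that [d_m] is coverable for the capacity
      [y j] ([APC2_Ry_coverable], [coverable_APC2_Ry]).  The optimal value is
      thus the least coverable distance, which is the least fixed point of
      [calL'].
    - Finally [Num.min (y j) (1 - y i) <= y j], so the fixed points of [calL]
      are among those of [calL']. *)

(** * Infima as optimal values *)

Lemma optimal_value_approx (R : realType) (V : Type) (P : set V) (f : V -> R)
    (m e : R) :
  optimal_value P f = m%:E -> 0 < e -> exists2 v, P v & f v < m + e.
Proof.
move=> opt e0.
have [|_ [v Pv <-]] := @ereal_inf_lt _ [set (f v)%:E | v in P] (m + e)%:E.
  by rewrite -/(optimal_value P f) opt lte_fin ltrDl.
by rewrite lte_fin; exists v.
Qed.

Lemma optimal_value_attained (R : realType) (V : Type) (P : set V) (f : V -> R)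
    (m : R) (v : V) :
  P v -> f v = m -> (forall w, P w -> m <= f w) -> optimal_value P f = m%:E.
Proof.
move=> Pv fv lb; apply/eqP; rewrite eq_le; apply/andP; split.
  by apply: ereal_inf_lbound; exists v => //; rewrite fv.
by apply: le_ereal_inf_tmp => _ [w Pw <-]; rewrite lee_fin lb.
Qed.

(** * Compactness of the unit box *)

Section Compactness.
Import numFieldNormedType.Exports.
Variable R : realType.

Section RealValued.
Variable T : topologicalType.
Implicit Types f g : T -> R.

Lemma cont_const (a : R) : continuous (fun _ : T => a).
Proof. by move=> y; exact: cvg_cst. Qed.

Lemma cont_add f g :
  continuous f -> continuous g -> continuous (fun y => f y + g y).
Proof. by move=> cf cg y; apply: cvgD; [exact: cf|exact: cg]. Qed.

Lemma cont_sub f g :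
  continuous f -> continuous g -> continuous (fun y => f y - g y).
Proof. by move=> cf cg y; apply: cvgB; [exact: cf|exact: cg]. Qed.

Lemma cont_scale f (a : R) :
  continuous f -> continuous (fun y => a * f y).
Proof. by move=> cf y; apply: cvgM; [exact: cvg_cst|exact: cf]. Qed.

Lemma cont_norm f : continuous f -> continuous (fun y => `|f y|).
Proof. by move=> cf y; apply: cvg_norm; exact: cf. Qed.

Lemma cont_min f g :
  continuous f -> continuous g -> continuous (fun y => Num.min (f y) (g y)).
Proof. by move=> cf cg y; apply: continuous_min; [exact: cf|exact: cg]. Qed.

Lemma cont_max f g :
  continuous f -> continuous g -> continuous (fun y => Num.max (f y) (g y)).
Proof. by move=> cf cg y; apply: continuous_max; [exact: cf|exact: cg]. Qed.

Lemma cont_sum (I : Type) (r : seq I) (P : pred I) (f : I -> T -> R) :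
  (forall i, P i -> continuous (f i)) ->
  continuous (fun y => \sum_(i <- r | P i) f i y).
Proof.
apply: (@continuous_big R I +%R 0 P) => x.
by apply: cvgD; [exact: cvg_fst|exact: cvg_snd].
Qed.

End RealValued.

Variable N : finType.
Local Notation pts := (prod_topology (fun _ : N => R : topologicalType)).

Lemma cont_coord (i : N) : continuous (fun y : pts => (y i : R)).
Proof. exact: (@proj_continuous N (fun=> R : topologicalType) i). Qed.

(** The constraints are turned into one continuous penalty; it attains its
    minimum on the box, and the approximate solutions force this minimum to be
    zero. *)
Lemma box_approx_solution (g : N -> pts -> R) (s : R) :
  (forall i, continuous (g i)) ->
  (forall e, 0 < e -> exists y : N -> R,
    [/\ \sum_j y j = s, forall j, 0 <= y j <= 1 & forall i, g i y <= e]) ->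
  exists y : N -> R,
    [/\ \sum_j y j = s, forall j, 0 <= y j <= 1 & forall i, g i y <= 0].
Proof.
move=> cg approx.
pose A : set pts := [set y | forall j, `[0, 1]%classic (y j)].
have inA (y : pts) : (forall j, 0 <= y j <= 1) -> y \in A.
  by move=> y01; rewrite inE => j /=; rewrite in_itv /= y01.
pose h (y : N -> R) : R := `|\sum_j y j - s| + \sum_i Num.max 0 (g i y).
have cA : compact A.
  exact: (@tychonoff N (fun=> R : topologicalType) (fun=> `[0, 1]%classic)
    (fun=> @segment_compact R 0 1)).
have ch : continuous (h : pts -> R).
  have csum : continuous (fun y : pts => \sum_j (y j : R) : R).
    by apply: cont_sum => j _; exact: cont_coord.
  have ccst := @cont_const pts.
  have cmax i : continuous (fun y : pts => Num.max 0 (g i y)).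
    exact: (@cont_max pts (fun=> 0) (g i) (ccst 0) (cg i)).
  have csmax : continuous (fun y : pts => \sum_i Num.max 0 (g i y)).
    exact: (@cont_sum pts N _ xpredT _ (fun i _ => cmax i)).
  have cdist := @cont_norm pts _ (@cont_sub pts _ _ csum (ccst s)).
  exact: (@cont_add pts _ _ cdist csmax).
have A0 : A !=set0.
  have [y [_ y01 _]] := approx 1 ltr01.
  by exists y; have := inA _ y01; rewrite inE.
have [|c cAin hmin] := @compact_EVT_min pts R (h : pts -> R) A A0 cA.
  exact: continuous_subspaceT.
have h_le0 : h c <= 0.
  rewrite leNgt; apply/negP => hc0.
  (* Each of the [#|N|] excesses is at most this, so that their sum stays
     below [h c]; the successor makes this strict and handles empty [N]. *)
  have e0 : 0 < h c / (#|N|.+1)%:R by rewrite divr_gt0.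
  have [y [ys y01 gy]] := approx _ e0.
  have := hmin y (inA _ y01); apply/negP; rewrite -ltNge.
  rewrite /h ys subrr normr0 add0r.
  apply: (@le_lt_trans _ _ (\sum_(i : N) (h c / (#|N|.+1)%:R))).
    by apply: ler_sum => i _; rewrite ge_max (ltW e0) gy.
  rewrite sumr_const -[ltLHS]mulr_natr mulrAC ltr_pdivrMr //.
  by rewrite ltr_pM2l // ltr_nat.
have max_ge0 i : true -> 0 <= Num.max 0 (g i c).
  by move=> _; rewrite le_max lexx.
have := h_le0; rewrite le_eqVlt ltNge addr_ge0 ?sumr_ge0 //= orbF.
rewrite paddr_eq0 ?sumr_ge0 // normr_eq0 subr_eq0 => /andP[/eqP cs].
rewrite psumr_eq0 // => /allP g0.
exists c; split => // [j|i].
  by move: cAin; rewrite inE => /(_ j) /=; rewrite in_itv.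
have /eqP <- := g0 i (mem_index_enum _).
by rewrite le_max lexx orbT.
Qed.
End Compactness.

(** * Fractional coverings *)

Section Covering.
Import numFieldNormedType.Exports.
Variables (R : realType) (N : finType) (d : N -> N -> R) (p alpha : nat).

Local Notation pts := (prod_topology (fun _ : N => R : topologicalType)).

(** Upper bounds on the assignment [x i j], as functions of the locations [y];
    the two linear programs differ only by this bound. *)
Definition capacity := (N -> R) -> N -> N -> R.

Definition open_capacity : capacity := fun y i j => y j.

(** The combination of [lp_open] and of [y i + x i j <= 1]. *)
Definition min_capacity : capacity := fun y i j => Num.min (y j) (1 - y i).

Definition fractional_location (y : N -> R) : Prop :=
  \sum_j y j = p%:R /\ forall j, 0 <= y j <= 1.

Definition covers (cap : capacity) (LB : R) (y : N -> R) : Prop :=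
  forall i, alpha%:R * (1 - y i) <=
    \sum_(j | (j != i) && (d i j <= LB)) cap y i j.

Definition coverable (cap : capacity) (LB : R) : Prop :=
  exists2 y, fractional_location y & covers cap LB y.

Definition admissible_capacity (cap : capacity) : Prop :=
  forall y, (forall j, 0 <= y j <= 1) ->
  forall i j, 0 <= cap y i j <= y j.

Lemma admissible_open_capacity : admissible_capacity open_capacity.
Proof. by move=> y y01 i j; rewrite lexx andbT; case/andP: (y01 j). Qed.

Lemma admissible_min_capacity : admissible_capacity min_capacity.
Proof.
move=> y y01 i j; have /andP[yj0 yj1] := y01 j; have /andP[yi0 yi1] := y01 i.
by rewrite /min_capacity ge_min lexx le_min yj0 subr_ge0 yi1.
Qed.

Lemma covers_min_open (LB : R) (y : N -> R) :
  covers min_capacity LB y -> covers open_capacity LB y.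
Proof.
move=> cov i; apply: le_trans (cov i) _; apply: ler_sum => j _.
by rewrite /min_capacity ge_min lexx.
Qed.

Lemma coverable_min_open (LB : R) :
  coverable min_capacity LB -> coverable open_capacity LB.
Proof. by move=> [y yfrac ycov]; exists y => //; exact: covers_min_open. Qed.

Lemma fractional_location_lt1 (y : N -> R) :
  (p < #|N|)%N -> fractional_location y -> exists i, y i < 1.
Proof.
move=> ltpN [ysum y01]; apply/not_existsP => y1.
have /eqP := ysum; apply/negP; rewrite gt_eqF //.
rewrite (eq_bigr (fun=> 1)) ?sumr_const ?ltr_nat // => j _.
apply/eqP; rewrite eq_le [1 <= _]leNgt; have /andP[_ ->] := y01 j.
by apply/negP.
Qed.

(** Subtracting [LB] times [lp_assign] from [lp_radius_sum] bounds the total of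
    [(max LB (d i j) - LB) * x i j] by [alpha * (z - LB)]; so each assignment
    farther than [LB] is at most a constant times [z - LB], and only they can
    serve the demand in excess of the near capacity. *)
Lemma unmet_demand_le (LB z : R) (y : N -> R) (x : N -> N -> R) (c : N -> R) i :
  APCLB_common d p alpha LB y x z ->
  (forall j, j != i -> x i j <= c j) ->
  alpha%:R * (1 - y i) - \sum_(j | (j != i) && (d i j <= LB)) c j <=
    (\sum_(j | (j != i) && (LB < d i j)) (d i j - LB)^-1) *
    (alpha%:R * (z - LB)).
Proof.
case=> _ assign _ radius x0 _ _ xc.
set excess := alpha%:R * (z - LB).
pose w j := (Num.max LB (d i j) - LB) * x i j.
have w0 j : j != i -> 0 <= w j.
  by move=> ji; rewrite mulr_ge0 ?x0 1?eq_sym // subr_ge0 le_max lexx.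
have w_excess : \sum_(j | j != i) w j <= excess.
  rewrite /w; under eq_bigr => j _ do rewrite mulrBl.
  rewrite sumrB -mulr_sumr assign /excess.
  by have := radius i; lra.
have far j : (j != i) && (LB < d i j) -> x i j <= (d i j - LB)^-1 * excess.
  case/andP=> ji far_j; rewrite mulrC ler_pdivlMr ?subr_gt0 //.
  apply: le_trans w_excess; rewrite (bigD1 j) //= /w max_r ?(ltW far_j) //.
  by rewrite mulrC lerDl sumr_ge0 // => k /andP[ki _]; exact: w0.
rewrite -assign (bigID (fun j => d i j <= LB)) /= mulr_suml.
have near_le := @ler_sum R N _ (fun j => (j != i) && (d i j <= LB)) _ _
  (fun j Pj => xc j (andP Pj).1).
have far_le : \sum_(j | (j != i) && ~~ (d i j <= LB)) x i j <=
    \sum_(j | (j != i) && (LB < d i j)) (d i j - LB)^-1 * excess.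
  by under eq_bigl => j do rewrite -ltNge; apply: ler_sum => j; exact: far.
by rewrite lerBlDl lerD // near_le.
Qed.

(** By [unmet_demand_le], solutions with [z] close to [LB] yield locations
    that violate the covering constraints by little; compactness removes the
    violation. *)
Lemma coverable_of_approx (cap : capacity) (LB : R) :
  (forall i j, continuous (fun y : pts => cap y i j : R)) ->
  (forall e, 0 < e -> exists y x z, [/\ APCLB_common d p alpha LB y x z,
     forall i j, i != j -> x i j <= cap y i j & z <= LB + e]) ->
  coverable cap LB.
Proof.
move=> cap_cont approx.
pose g i (y : N -> R) : R :=
  alpha%:R * (1 - y i) - \sum_(j | (j != i) && (d i j <= LB)) cap y i j.
have [i|e e0|y [ysum y01 ycov]] := @box_approx_solution R N g p%:R.
- have ccst := @cont_const R pts.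
  have csum : continuous (fun y : pts =>
      \sum_(j | (j != i) && (d i j <= LB)) cap y i j).
    exact: (@cont_sum R pts N _ _ _ (fun j _ => cap_cont i j)).
  have c1 : continuous (fun y : pts => 1 - (y i : R)).
    exact: (@cont_sub R pts (fun=> 1) _ (ccst 1) (@cont_coord R N i)).
  apply: (@cont_sub R pts _ _ _ csum).
  exact: (@cont_scale R pts _ alpha%:R c1).
- pose C := \sum_i \sum_(j | (j != i) && (LB < d i j)) (d i j - LB)^-1.
  have Ci0 i : 0 <= \sum_(j | (j != i) && (LB < d i j)) (d i j - LB)^-1.
    by apply: sumr_ge0 => j /andP[_ far]; rewrite invr_ge0 subr_ge0 ltW.
  have C0 : 0 <= C by apply: sumr_ge0 => i _; exact: Ci0.
  (* [D] dominates the constant of [unmet_demand_le] for every [i] at once and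
     is positive even when no distance exceeds [LB]. *)
  pose D := (C + 1) * (alpha%:R + 1).
  have D0 : 0 < D by rewrite mulr_gt0 // ltr_wpDl // ler0n.
  have [y [x [z [common xcap zle]]]] := approx _ (divr_gt0 e0 D0).
  exists y; split; [exact: lp_card common|exact: lp_y_01 common|move=> i].
  have xi j : j != i -> x i j <= cap y i j.
    by move=> ji; apply: xcap; rewrite eq_sym.
  rewrite /g.
  apply: le_trans (@unmet_demand_le LB z y x (cap y i) i common xi) _.
  have z0 : 0 <= z - LB by rewrite subr_ge0; exact: lp_z_ge common.
  have zD : (z - LB) * D <= e by rewrite -ler_pdivlMr // lerBlDl.
  apply: le_trans zD; rewrite mulrA [leRHS]mulrC ler_wpM2r //.
  rewrite /D ler_pM ?ler0n ?lerDl //.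
  by rewrite ler_wpDr // /C [leRHS](bigD1 i) //= lerDl sumr_ge0.
- by exists y => // i; have := ycov i; rewrite /g subr_le0.
Qed.

(** A demand below the total capacity is met by scaling all capacities by the
    same ratio. *)
Lemma proportional_assignment (I : finType) (P : pred I) (c : I -> R) (t : R) :
  (forall j, P j -> 0 <= c j) -> 0 <= t <= \sum_(j | P j) c j ->
  exists x : I -> R,
    [/\ forall j, P j -> 0 <= x j <= c j, forall j, ~~ P j -> x j = 0 &
        \sum_(j | P j) x j = t].
Proof.
move=> c0 /andP[t0 tc]; set s := \sum_(j | P j) c j in tc.
exists (fun j => if P j then c j * (t / s) else 0); split => [j Pj|j|].
(* If the total capacity is zero, so is [t], and [t / 0 = 0] is the right
   ratio. *)
- rewrite Pj mulr_ge0 ?c0 ?divr_ge0 ?(le_trans t0 tc) //=.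
  have [s0|s_neq0] := eqVneq s 0; first by rewrite s0 invr0 !mulr0 c0.
  rewrite ler_piMr ?c0 // ler_pdivrMr ?mul1r //.
  by rewrite lt_neqAle eq_sym s_neq0 (le_trans t0 tc).
- by move/negbTE->.
- rewrite (eq_bigr (fun j => c j * (t / s))) => [|j ->//].
  rewrite -mulr_suml -/s.
  have [s0|s_neq0] := eqVneq s 0; last by rewrite mulrC divfK.
  by rewrite s0 mul0r; apply/eqP; rewrite eq_le t0 -s0 tc.
Qed.

(** Assigning only at distance at most [LB] makes [lp_radius_sum] an equality
    for [z = LB]. *)
Lemma covers_solution (cap : capacity) (LB : R) (y : N -> R) :
  admissible_capacity cap -> fractional_location y -> covers cap LB y ->
  exists x : N -> N -> R, APCLB_common d p alpha LB y x LB /\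
    forall i j, i != j ->
      (x i j <= cap y i j) /\ (LB < d i j -> x i j = 0).
Proof.
move=> cap_adm [ysum y01] cov.
have ysub i : 0 <= 1 - y i by rewrite subr_ge0; case/andP: (y01 i).
have cap0 i j : 0 <= cap y i j by case/andP: (cap_adm y y01 i j).
have capy i j : cap y i j <= y j by case/andP: (cap_adm y y01 i j).
have /boolp.choice[x xP] : forall i, exists xi : N -> R,
    [/\ forall j, (j != i) && (d i j <= LB) -> 0 <= xi j <= cap y i j,
        forall j, ~~ ((j != i) && (d i j <= LB)) -> xi j = 0 &
        \sum_(j | (j != i) && (d i j <= LB)) xi j = alpha%:R * (1 - y i)].
  move=> i; apply: proportional_assignment => [j _|]; first exact: cap0.
  by rewrite cov mulr_ge0.
have xle i j : 0 <= x i j <= cap y i j.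
  have [near far _] := xP i.
  case: (boolP ((j != i) && (d i j <= LB))) => [/near//|/far->].
  by rewrite lexx cap0.
have xfar i j : LB < d i j -> x i j = 0.
  move=> far; have [_ x0 _] := xP i; apply: x0.
  by rewrite negb_and -ltNge far orbT.
have xsum i : \sum_(j | j != i) x i j = alpha%:R * (1 - y i).
  have [_ far <-] := xP i; rewrite (bigID (fun j => d i j <= LB)) /=.
  rewrite [X in _ + X]big1 ?addr0 // => j /andP[_].
  by rewrite -ltNge; exact: xfar.
exists x; split; last by move=> i j _; split; [case/andP: (xle i j)|exact: xfar].
split => //.
- by move=> i j _; apply: le_trans (capy i j); case/andP: (xle i j).
- move=> i.
  have -> : \sum_(j | j != i) Num.max LB (d i j) * x i j =
            LB * \sum_(j | j != i) x i j.
    rewrite mulr_sumr; apply: eq_bigr => j _.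
    by have [near|/xfar->] := leP (d i j) LB; rewrite ?mulr0.
  by rewrite xsum; lra.
- by move=> i j _; case/andP: (xle i j).
Qed.

End Covering.

(** * Feasible solutions of the semi-relaxation *)

Section SemiRelaxation.
Variables (R : realType) (N : finType) (d : N -> N -> R) (p alpha : nat).

Local Notation coverable := (coverable d p alpha).
Local Notation open_capacity := (@open_capacity R N).
Local Notation dists := (dists d).
Local Notation dist_ := (dist_ d).
Local Notation K := (K d).

Lemma mem_dists i j : j != i -> d i j \in dists.
Proof.
move=> ji; rewrite mem_sort mem_undup.
by apply/fintype.imageP; exists (i, j); rewrite // inE eq_sym.
Qed.

Lemma dist_index r : r \in dists -> exists2 k, (1 <= k <= K)%N & dist_ k = r.
Proof.
move=> rd; exists (index r dists).+1; last exact: nth_index.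
by rewrite /= /Defs.K index_mem.
Qed.

Lemma ltr_dist k l : (1 <= k <= K)%N -> (1 <= l <= K)%N ->
  (dist_ k < dist_ l) = (k < l)%N.
Proof.
move=> /andP[k1 kK] /andP[l1 lK].
have sorted_dists : sorted <%R dists by rewrite sort_lt_sorted undup_uniq.
rewrite /dist_ lt_sorted_ltn_nth ?inE ?prednK //.
by rewrite -ltnS !prednK.
Qed.

Lemma ler_dist k l : (1 <= k <= K)%N -> (1 <= l <= K)%N ->
  (dist_ k <= dist_ l) = (k <= l)%N.
Proof. by move=> kK lK; rewrite leNgt ltr_dist // -leqNgt. Qed.

(** The maximum with [1] matters only for [n = 0]. *)
Lemma step_of_binary_nonincreasing (u : nat -> R) (n : nat) :
  (forall k, (3 <= k <= n)%N -> u k <= u k.-1) ->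
  (forall k, (2 <= k <= n)%N -> u k = 0 \/ u k = 1) ->
  exists2 m, (1 <= m <= maxn 1 n)%N &
    forall k, (2 <= k <= n)%N -> u k = (k <= m)%N%:R.
Proof.
elim: n => [|n IHn] umono u01; first by exists 1 => //; lia.
have [k hk|k hk|m mn um] := IHn; [apply: umono; lia|apply: u01; lia|].
case: (ltnP n.+1 2) => n1; first by exists 1 => //; lia.
have [un|un] := u01 n.+1 ltac:(lia).
  exists m; first lia.
  move=> k kn; have [kn1|kn1] := eqVneq k n.+1; last by apply: um; lia.
  by rewrite kn1 un ltnNge (_ : m <= n)%N //; lia.
exists n.+1; first lia.
move=> k kn; have [->|kn1] := eqVneq k n.+1; first by rewrite un leqnn.
rewrite um; last lia.
congr (_%:R); congr (nat_of_bool _).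
have n2 : (2 <= n <= n)%N by lia.
have := umono n.+1 ltac:(lia); rewrite un um //=.
by case: leqP => //; [lia|rewrite ler10].
Qed.

Lemma objective_step (u : nat -> R) (y : N -> R) m :
  (1 <= m <= K)%N ->
  (forall k, (2 <= k <= K)%N -> u k = (k <= m)%N%:R) ->
  APC2_Ry_objective d (u, y) = dist_ m.
Proof.
move=> /andP[m1 mK] um; rewrite /APC2_Ry_objective /=.
rewrite (@big_cat_nat _ _ _ m.+1) //=.
rewrite [X in _ + (_ + X)]big_nat_cond [X in _ + (_ + X)]big1 ?addr0; last first.
  move=> k kP; rewrite um; last lia.
  by rewrite leqNgt (_ : m < k)%N ?mulr0 //; lia.
rewrite (eq_big_nat _ _ (F2 := fun k => dist_ k - dist_ k.-1)); last first.
  move=> k kP; rewrite um; last lia.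
  by rewrite (_ : k <= m)%N ?mulr1 //; lia.
rewrite big_add1 /= telescope_sumr //; lra.
Qed.

(** Let [d_m] be the objective value.  A point [i] with a neighbor farther than
    [d_m] has a nearest such neighbor, at some distance [d_k] in [D_i] with
    [k > m]; there [u k = 0], and [d i j < d_k] is the same as [d i j <= d_m].
    The other points are covered because all of [N] is within [d_m] of them. *)
Lemma APC2_Ry_coverable (v : (nat -> R) * (N -> R)) :
  (0 < alpha <= p)%N -> (0 < K)%N -> APC2_Ry d p alpha v ->
  coverable open_capacity (APC2_Ry_objective d v).
Proof.
case: v => u y halpha K0 [ysum umono cov u01 y01].
have [m mK um] := step_of_binary_nonincreasing umono u01.
have {}mK : (1 <= m <= K)%N by lia.
rewrite (objective_step y mK um).
exists y => // i; rewrite /open_capacity.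
have [/existsP[j1 far1]|none] := boolP [exists j, (j != i) && (dist_ m < d i j)].
  have [j /andP[ji far] jmin] :=
    @arg_minP _ _ N j1 (fun j => (j != i) && (dist_ m < d i j)) (d i) far1.
  have [k kK dk] := dist_index (mem_dists ji).
  have ltmk : (m < k)%N by rewrite -ltr_dist // dk.
  have dki : dist_ k \in dists_of d i.
    rewrite mem_filter dk gt_eqF /=; last first.
      by rewrite (le_lt_trans _ far) // ler_dist //; lia.
    by apply/fintype.imageP; exists j => //; rewrite !inE.
  have := cov i k ltac:(lia) dki; rewrite um; last lia.
  rewrite leqNgt ltmk mulr0 add0r => /le_trans; apply.
  rewrite le_eqVlt; apply/orP; left; apply/eqP; apply: eq_bigl => l.
  have [li|//] := boolP (l != i) => /=; rewrite dk; apply/idP/idP.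
    move=> lt_lj; rewrite leNgt; apply/negP => farl.
    by have := jmin l; rewrite li farl leNgt lt_lj => /(_ isT).
  by move=> /le_lt_trans; apply.
(* All points are near [i], whose demand is met as [p >= alpha >= 1]. *)
rewrite (eq_bigl (fun j => j != i)) => [|j]; last first.
  have [ji|//] := boolP (j != i); rewrite leNgt.
  by move/existsPn: none => /(_ j); rewrite ji.
have -> : \sum_(j | j != i) y j = p%:R - y i.
  by rewrite -ysum [in RHS](bigD1 i) //=; lra.
have /andP[y0 y1] := y01 i.
have a1 : 1 <= alpha%:R :> R by rewrite ler1n; lia.
have ap : alpha%:R <= p%:R :> R by rewrite ler_nat; lia.
nra.
Qed.

(** For the step function at the index of [d i j], a constraint is trivial up
    to the step; beyond it, [d i j < d_l], so its sum ranges over at least the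
    points of the covering condition. *)
Lemma coverable_APC2_Ry i j :
  j != i -> coverable open_capacity (d i j) ->
  exists2 v, APC2_Ry d p alpha v & APC2_Ry_objective d v = d i j.
Proof.
move=> ji [y [ysum y01] cov].
have [m mK dm] := dist_index (mem_dists ji).
pose u k : R := (k <= m)%N%:R.
exists (u, y); last by rewrite (@objective_step u y m mK).
split => //.
- by move=> k kP; rewrite /u ler_nat; lia.
- move=> k l lP _; rewrite /u; have [lm|ml] := leqP l m.
    rewrite mulr1; have /andP[yk0 _] := y01 k.
    have s0 : 0 <= \sum_(j0 | (j0 != k) && (d k j0 < dist_ l)) y j0.
      by rewrite sumr_ge0 // => h _; case/andP: (y01 h).
    have : 0 <= alpha%:R * y k by rewrite mulr_ge0.
    lra.
  rewrite mulr0 add0r; apply: le_trans (cov k) _.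
  rewrite [leRHS](bigID (fun h => d k h <= d i j)) /= -[leLHS]addr0 lerD //.
    rewrite le_eqVlt; apply/orP; left; apply/eqP; apply: eq_bigl => h.
    rewrite -andbA; congr (_ && _); apply/idP/andP => [near|[]//].
    by rewrite near (le_lt_trans near) // -dm ltr_dist //; lia.
  by rewrite sumr_ge0 // => h _; case/andP: (y01 h).
- by move=> k _; rewrite /u; case: leqP; [right|left].
Qed.

End SemiRelaxation.

(** * Least coverable bounds and fixed points *)

Section Instance.
Import numFieldNormedType.Exports.
Variables (R : realType) (N : finType) (d : N -> N -> R) (p alpha : nat).
Hypothesis hd : forall i j : N, 0 <= d i j.
Hypothesis hp : (0 < p < #|N|)%N.
Hypothesis halpha : (0 < alpha <= p)%N.

Local Notation pts := (prod_topology (fun _ : N => R : topologicalType)).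
Local Notation coverable := (coverable d p alpha).
Local Notation open_capacity := (@open_capacity R N).
Local Notation min_capacity := (@min_capacity R N).

(** Since [p < #|N|], some point is not fully open; its positive demand needs
    a neighbor within [LB]. *)
Lemma coverable_ge_dist (cap : capacity R N) (LB : R) :
  coverable cap LB -> exists i j, j != i /\ d i j <= LB.
Proof.
move=> [y yfrac ycov].
have [i yi] := fractional_location_lt1 (andP hp).2 yfrac.
have [|none] := boolP [exists j, (j != i) && (d i j <= LB)].
  by case/existsP=> j /andP[ji dj]; exists i, j.
have := ycov i; rewrite big_pred0 => [|j]; last first.
  by apply/negbTE; move/existsPn: none; apply.
rewrite leNgt mulr_gt0 // ?subr_gt0 // ltr0n; lia.
Qed.

(** [LB] may be lowered to the largest distance not exceeding it, for the
    comparisons [d k l <= LB] do not change. *)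
Lemma coverable_at_dist (cap : capacity R N) (LB : R) :
  coverable cap LB ->
  exists i j, [/\ j != i, d i j <= LB & coverable cap (d i j)].
Proof.
move=> cov; have [i0 [j0 [ji0 dj0]]] := coverable_ge_dist cov.
pose P (ij : N * N) := (ij.2 != ij.1) && (d ij.1 ij.2 <= LB).
have P0 : P (i0, j0) by rewrite /P ji0.
have [[i j] /andP[/= ji dj] dmax] := arg_maxP (fun ij => d ij.1 ij.2) P0.
exists i, j; split => //; have [y yfrac ycov] := cov.
exists y => // k; apply: le_trans (ycov k) _.
rewrite le_eqVlt; apply/orP; left; apply/eqP; apply: eq_bigl => l.
have [lk|//] := boolP (l != k) => /=; apply/idP/idP => [dl|/le_trans]; last exact.
by apply: (dmax (k, l)); rewrite /P /= lk dl.
Qed.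

(** There are finitely many distances, so a minimum over the coverable ones
    exists, and it is a minimum over all coverable bounds. *)
Lemma least_coverable (cap : capacity R N) (L0 : R) :
  coverable cap L0 ->
  exists i j, [/\ j != i, coverable cap (d i j) &
    forall LB, coverable cap LB -> d i j <= LB].
Proof.
move=> /coverable_at_dist[i0 [j0 [ji0 _ cov0]]].
pose P (ij : N * N) := (ij.2 != ij.1) && `[< coverable cap (d ij.1 ij.2) >].
have P0 : P (i0, j0) by rewrite /P ji0; exact/asboolP.
have [[i j] /andP[/= ji /asboolP covij] dmin] :=
  arg_minP (fun ij => d ij.1 ij.2) P0.
exists i, j; split => // LB /coverable_at_dist[k [l [lk dkl covkl]]].
by apply: le_trans dkl; apply: (dmin (k, l)); rewrite /P lk; exact/asboolP.
Qed.

(** Once all points are within [LB] of each other, opening any [p] points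
    serves each other point with [p >= alpha] neighbors. *)
Lemma exists_coverable : exists LB, coverable min_capacity LB.
Proof.
have /andP[p0 ltpN] := hp; have /andP[a0 leap] := halpha.
pose A := [set j in take p (enum N)]%SET.
have cardA : #|A| = p.
  rewrite cardsE; have /card_uniqP -> : uniq (take p (enum N)).
    by rewrite take_uniq ?enum_uniq.
  by rewrite size_takel // -cardE ltnW.
exists (\sum_(ij : N * N) d ij.1 ij.2).
have far i j : d i j <= \sum_(ij : N * N) d ij.1 ij.2.
  by rewrite (bigD1 (i, j)) //= lerDl sumr_ge0.
have sumA : \sum_j ((j \in A)%:R : R) = p%:R.
  rewrite -cardA -sum1_card natr_sum [RHS]big_mkcond /=.
  by apply: eq_bigr => j _; case: (j \in A).
exists (fun j => (j \in A)%:R).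
  by split => // j; rewrite ler0n lern1 leq_b1.
move=> i; rewrite /min_capacity; case: (boolP (i \in A)) => iA.
  by rewrite subrr mulr0 sumr_ge0 // => j _; rewrite le_min lexx ler0n.
rewrite subr0 mulr1 (eq_bigl (fun j => j != i)) => [|j]; last by rewrite far andbT.
apply: (@le_trans _ _ p%:R); first by rewrite ler_nat.
rewrite -sumA (bigD1 i) //= (negbTE iA) add0r ler_sum // => j _.
by rewrite le_min lexx lern1 leq_b1.
Qed.

(** The bound of [LB * y i + max LB (d i j) * x i j] by [z] is harmless at
    [z = LB >= 0]: it reads [LB * (y i + x i j) <= LB] for near points, which
    follows from the capacity, and [LB * y i <= LB] for far ones. *)
Lemma calL_coverable (LB : R) :
  calL d p alpha LB = LB%:E <-> coverable min_capacity LB.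
Proof.
split => [opt|cov].
  apply: coverable_of_approx => [i j|e e0].
    have c1 := @cont_sub R pts _ _ (@cont_const R pts 1) (@cont_coord R N i).
    exact: (@cont_min R pts _ _ (@cont_coord R N j) c1).
  have [[[y x] z] [com capy _] /= zlt] := optimal_value_approx opt e0.
  exists y, x, z; split => //; last exact: ltW.
  move=> i j ij; rewrite le_min (lp_open com) //=.
  by have := capy i j ij; lra.
have [i [j [ji dij]]] := coverable_ge_dist cov.
have LB0 : 0 <= LB := le_trans (hd i j) dij.
have [y yfrac ycov] := cov.
have [x [com xP]] := covers_solution (@admissible_min_capacity R N) yfrac ycov.
apply: (@optimal_value_attained _ _ _ _ _ (y, x, LB)) => //; last first.
  by move=> [[? ?] ?] [/lp_z_ge].
have yx k l : k != l -> y k + x k l <= 1.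
  by move=> /xP[]; rewrite le_min; lra.
split => // k l kl; have [_ xfar] := xP k l kl.
have [near|/xfar->] := leP (d k l) LB.
  by rewrite -mulrDr ler_piMr // yx.
by rewrite mulr0 addr0 ler_piMr //; have /andP[] := lp_y_01 com k.
Qed.

Lemma calL'_coverable (LB : R) :
  calL' d p alpha LB = LB%:E <-> coverable open_capacity LB.
Proof.
split => [opt|cov].
  apply: coverable_of_approx => [i j|e e0]; first exact: cont_coord.
  have [[[y x] z] [com _] /= zlt] := optimal_value_approx opt e0.
  exists y, x, z; split => //; last exact: ltW.
  by move=> i j ij; exact: lp_open com _ _ ij.
have [i [j [ji dij]]] := coverable_ge_dist cov.
have LB0 : 0 <= LB := le_trans (hd i j) dij.
have [y yfrac ycov] := cov.
have [x [com xP]] := covers_solution (@admissible_open_capacity R N) yfrac ycov.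
apply: (@optimal_value_attained _ _ _ _ _ (y, x, LB)) => //; last first.
  by move=> [[? ?] ?] [/lp_z_ge].
split => // k l kl; have [xle xfar] := xP k l kl.
have [near|/xfar->] := leP (d k l) LB; last by rewrite mulr0.
rewrite ler_piMr // (le_trans xle) //.
by have /andP[] := lp_y_01 com l.
Qed.

End Instance.

(** * The three bounds *)

Theorem theorem21 (R : realType) (N : finType) (d : N -> N -> R) (p alpha : nat)
  (hd : forall i j : N, 0 <= d i j)
  (hp : (0 < p < #|N|)%N) (halpha : (0 < alpha <= p)%N) :
  exists LBsharp LBsharp' LBstar : R,
    [/\ is_minimum [set LB : R | calL d p alpha LB = LB%:E] LBsharp,
        is_minimum [set LB : R | calL' d p alpha LB = LB%:E] LBsharp',
        APC2_Ry_value d p alpha = LBstar%:E,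
        LBsharp >= LBsharp' &
        LBsharp' = LBstar].
Proof.
have [L0 cov0] := exists_coverable hd hp halpha.
have [i [j [ji covij minij]]] := least_coverable hp halpha cov0.
have [k [l [lk covkl minkl]]] :=
  least_coverable hp halpha (coverable_min_open cov0).
exists (d i j), (d k l), (d k l); split => //.
- split => [|LB /(calL_coverable hd hp halpha)]; last exact: minij.
  exact/(calL_coverable hd hp halpha).
- split => [|LB /(calL'_coverable hd hp halpha)]; last exact: minkl.
  exact/(calL'_coverable hd hp halpha).
- have [v vP vobj] := coverable_APC2_Ry lk covkl.
  apply: (optimal_value_attained vP vobj) => w wP.
  apply/minkl/APC2_Ry_coverable => //.
  by have := mem_dists d lk; rewrite -index_mem; exact: leq_ltn_trans (leq0n _).
- exact/minkl/coverable_min_open.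
Qed.
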